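(* Let $a,b,g,h$ be real functions that are Lebesgue measurable and locally essentially bounded, with $a(t)\ge 0$, $b(t)\ge 0$, $g(t)\le t$, $h(t)\ge t$ and $\lim_{t\to\infty} g(t)=\infty$. Suppose that for $t$ sufficiently large $b(t)\ge a(t)$ and $$a(t)\ge b(t)\left[\exp\left\{\int_t^{h(t)}b(s)\,ds\right\}-1\right]\exp\left\{\int_{g(t)}^t b(s)\,ds\right\}.$$ Then there exists an eventually positive solution with an eventually nonnegative derivative of the equation $$\dot{x}(t)+a(t)x(g(t))-b(t)x(h(t))=0,\quad t\ge t_0.$$
   Context: The functions $a,b,g,h$ are considered for $t\ge t_0$. A solution of the differential equation is a function $x:\mathbb{R}\to\mathbb{R}$, absolutely continuous on each interval $[t_0,c]$, which satisfies the equation for almost all $t\in[t_0,\infty)$ and satisfies $x(t)=\varphi(t)$ for $t<t_0$, $x(t_0)=x_0$, for some initial function $\varphi$ and initial value $x_0$. ''Eventually'' means for all sufficiently large $t$; sign conditions on derivatives are understood almost everywhere.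
   Formalization: The solution is taken from some starting point t1 ≥ t0 instead of exactly t0 (equation and initial data posed at t1), since the inequalities hold only for sufficiently large t and a positive solution starting at t0 itself may fail to exist. *)

(* Defs.v *)
From mathcomp Require Import all_boot all_order all_algebra.
From mathcomp Require Import all_classical all_reals all_analysis.

Set Implicit Arguments.
Unset Strict Implicit.
Unset Printing Implicit Defensive.

Import Order.TTheory GRing.Theory Num.Theory.
Import numFieldNormedType.Exports.

Local Open Scope classical_set_scope.
Local Open Scope ring_scope.

(* R equipped with the Lebesgue sigma-algebra, i.e. the (Caratheodory) domain
   of completed_lebesgue_measure.  R itself carries the Borel sigma-algebra. *)
Definition lebesgueType (R : realType) :=
  caratheodory_type (@wlength R idfun)^*%mu.

Notation leb R := (@completed_lebesgue_measure R).

(* Lebesgue-to-Borel measurability of a real function on D. *)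
Definition lebesgue_measurable (R : realType) (D : set R) (f : R -> R) : Prop :=
  @measurable_fun _ _ (lebesgueType R) (measurableTypeR R) D f.

Definition locally_ess_bounded (R : realType) (t0 : R) (f : R -> R) : Prop :=
  forall c : R, exists M : R,
    {ae leb R, forall t : R, t0 <= t <= c -> `|f t| <= M}.

Definition absolutely_continuous (R : realType) (c d : R) (f : R -> R) : Prop :=
  forall e : R, 0 < e -> exists2 r : R, 0 < r &
    forall (n : nat) (u v : 'I_n -> R),
      (forall i, c <= u i /\ u i <= v i /\ v i <= d) ->
      trivIset setT (fun i => `]u i, v i[%classic : set R) ->
      \sum_(i < n) (v i - u i) < r ->
      \sum_(i < n) `|f (v i) - f (u i)| < e.

(* x solves the initial value problem
     x'(t) + a(t) x(g(t)) - b(t) x(h(t)) = 0 for almost all t >= t0,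
     x = phi on ]-oo, t0[,  x(t0) = x0.
   Differentiability is required separately because derive1 is a total operator.
   Only the values of phi on ]-oo, t0[ matter. *)
Record mixed_solution (R : realType) (a b g h : R -> R) (t0 : R)
    (phi : R -> R) (x0 : R) (x : R -> R) : Prop := MixedSolution {
  mixed_solution_ac : forall c : R, t0 <= c -> absolutely_continuous t0 c x;
  mixed_solution_eq : {ae leb R, forall t : R, t0 <= t ->
    derivable x t 1 /\ derive1 x t + a t * x (g t) - b t * x (h t) = 0};
  mixed_solution_initial_fun : forall t : R, t < t0 -> x t = phi t;
  mixed_solution_initial_val : x t0 = x0
}.

(* Main.v *)
Require Import Defs.
From mathcomp Require Import all_boot all_order all_algebra.
From mathcomp Require Import all_classical all_reals all_analysis.
From mathcomp Require Import measurable_realfun.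

(** Look for a solution of the form x = exp U, where U is the primitive of a
rate u.  Dividing the equation by x(t) turns it into the fixed-point problem

  u(t) = F u (t) := b(t) exp(U(h t) - U(t)) - a(t) exp(U(g t) - U(t)).

Since g(t) <= t <= h(t) and a, b >= 0, the operator F is monotone: enlarging u
enlarges the integral from t to h(t) and the integral from g(t) to t, hence
enlarges the first term and shrinks the second one.  The two hypotheses
on the coefficients say exactly that 0 <= F 0 (that is a <= b) and that
F b <= b (the exponential inequality).  The iterates of F starting at 0
therefore increase and stay below b; by monotone convergence their limit u is
a fixed point with 0 <= u <= b ([riccati_fixpoint]).  Then x = exp U is
positive, it is Lipschitz on compact intervals because b is locally bounded
([expR_primitive_ac]), and x' = u x >= 0 almost everywhere by Lebesgue
differentiation ([primitive_derivable]).

The iteration is carried out with Borel functions and bounds that hold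
everywhere, whereas the data are Lebesgue measurable and essentially bounded.
The bridge is a Borel null set Z outside which the data are Borel and b is
locally bounded ([lebesgue_measurable_borel_off_null],
[locally_ess_bounded_off_null]).  Off E = [T, +oo[ \ Z, where T is large, the
coefficients a, b are replaced by 0 and the deviations g, h by the identity.  This keeps
every pointwise hypothesis, including the exponential inequality: outside E
it reads 0 <= 0, and inside E its left-hand side can only decrease, because the
integrals of b shrink ([primitive_patch_le]).  The modified equation agrees
with the original one almost everywhere on [T, +oo[. *)

Set Implicit Arguments.
Unset Strict Implicit.
Unset Printing Implicit Defensive.

Import Order.TTheory GRing.Theory Num.Theory.
Import numFieldNormedType.Exports.

Local Open Scope classical_set_scope.
Local Open Scope ring_scope.

(** * Primitives of locally bounded rates *)

(** Vanishing to the left of [T] makes the integral over ]-oo, t] finite, so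
that one function of [t] encodes the integrals over all bounded intervals. *)
Record density (R : realType) (T : R) (u : R -> R) : Prop := Density {
  density_measurable : measurable_fun setT u;
  density_ge0 : forall t, 0 <= u t;
  density_eq0 : forall t, t < T -> u t = 0;
  density_bounded : forall c, exists M, forall t, t <= c -> u t <= M }.

Definition primitive (R : realType) (u : R -> R) (t : R) : R :=
  \int[@lebesgue_measure R]_(s in `]-oo, t]) u s.

Section primitive.
Variables (R : realType) (T : R).
Implicit Types u v : R -> R.
Notation mu := (@lebesgue_measure R).

Lemma density_le u v : density T v -> measurable_fun setT u ->
  (forall t, 0 <= u t <= v t) -> density T u.
Proof.
move=> dv mu_ uv; split => //.
- by move=> t; case/andP: (uv t).
- move=> t tT; apply/eqP; rewrite eq_le; case/andP: (uv t) => -> ut.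
  by rewrite -(density_eq0 dv tT) ut.
- move=> c; have [M MP] := density_bounded dv c; exists M => t tc.
  by case/andP: (uv t) => _ /le_trans; apply; exact: MP.
Qed.

Lemma density_integrable_itv u (s t : R) : density T u ->
  mu.-integrable `[s, t] (EFin \o u).
Proof.
move=> du; apply: measurable_bounded_integrable => //.
- rewrite [X in (X < _)%E]lebesgue_measure_itv/=; case: ifPn => _ //.
  by rewrite -EFinB ltry.
- exact: measurable_funS (density_measurable du).
- have [M MP] := density_bounded du t.
  exists M; split; [exact: num_real|move=> N MN x/=].
  rewrite in_itv/= => /andP[_ xt]; rewrite ger0_norm ?(density_ge0 du)//.
  by rewrite (le_trans (MP _ xt))// ltW.
Qed.

(** The integral over ]-oo, t] only sees [T, t], where the rate is bounded. *)
Lemma density_integrable u (t : R) : density T u ->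
  mu.-integrable `]-oo, t] (EFin \o u).
Proof.
move=> du; have mu_ := density_measurable du.
apply/integrableP; split.
  by apply/measurable_EFinP; exact: measurable_funS mu_.
rewrite (_ : (\int[mu]_(x in `]-oo, t]) _)%E =
             (\int[mu]_(x in `[T, t]) `|(EFin \o u) x|)%E).
  by case/integrableP: (density_integrable_itv T t du).
rewrite integral_mkcond [RHS]integral_mkcond; apply: eq_integral => x _.
rewrite !patchE; have [xT|Tx] := ltP x T.
  rewrite [X in _ = (if X then _ else _)](_ : _ = false).
    by case: ifPn => //= _; rewrite (density_eq0 du xT) normr0.
  by apply/negbTE/negP; rewrite inE/= in_itv/= leNgt xT.
congr (if _ then _ else _).
by apply/idP/idP; rewrite !inE/= !in_itv/= Tx.
Qed.

Lemma primitiveB u (s t : R) : density T u -> s <= t ->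
  primitive u t - primitive u s = \int[mu]_(r in `[s, t]) u r.
Proof.
move=> du st; rewrite /primitive Rintegral_itvB ?bnd_simp//.
  rewrite Rintegral_itv_obnd_cbnd//.
  by apply: integrableS (density_integrable_itv s t du) => //; exact: subset_itv_oc_cc.
exact: density_integrable.
Qed.

Lemma primitiveB_le u v (s t : R) : density T u -> density T v ->
  (forall r, u r <= v r) -> s <= t ->
  primitive u t - primitive u s <= primitive v t - primitive v s.
Proof.
move=> du dv uv st; rewrite !primitiveB//; apply: le_Rintegral => //.
- exact: density_integrable_itv.
- exact: density_integrable_itv.
Qed.

Lemma primitive_nd u (s t : R) : density T u -> s <= t ->
  primitive u s <= primitive u t.
Proof.
move=> du st; rewrite -subr_ge0 primitiveB//.
by apply: Rintegral_ge0 => x _; exact: (density_ge0 du).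
Qed.

(** Monotonicity already gives Borel measurability, so that composing with the
deviations [g] and [h] stays measurable. *)
Lemma primitive_measurable u : density T u ->
  measurable_fun setT (primitive u).
Proof.
by move=> du; apply: nondecreasing_measurable => // s t; exact: primitive_nd.
Qed.

Lemma primitive_lipschitz u (c M s t : R) : density T u ->
  (forall r, r <= c -> u r <= M) -> s <= t -> t <= c ->
  primitive u t - primitive u s <= M * (t - s).
Proof.
move=> du uM st tc; rewrite primitiveB//.
have -> : M * (t - s) = \int[mu]_(r in `[s, t]) (cst M r).
  rewrite Rintegral_cst//; congr (_ * _).
  move: st; rewrite le_eqVlt => /predU1P[->|st].
    by rewrite subrr set_itv1 [X in fine X]lebesgue_measure_set1.
  by rewrite [X in fine X]lebesgue_measure_itv/= lte_fin st.
apply: le_Rintegral => //.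
- exact: density_integrable_itv.
- apply: measurable_bounded_integrable => //.
  + rewrite [X in (X < _)%E]lebesgue_measure_itv/=; case: ifPn => _ //.
    by rewrite -EFinB ltry.
  + exists `|M|; split; [exact: num_real|move=> N MN x/= _; exact: ltW].
- by move=> r; rewrite /= in_itv/= => /andP[_ rt]; apply: uM; exact: le_trans tc.
Qed.

(** The monotone convergence theorem, read on primitives. *)
Lemma primitive_cvg (u : (R -> R)^nat) v t :
  (forall n, density T (u n)) -> density T v ->
  (forall x, nondecreasing_seq (u ^~ x)) ->
  (forall x, u n x @[n --> \oo] --> v x) ->
  primitive (u n) t @[n --> \oo] --> primitive v t.
Proof.
move=> du dv undec uv; rewrite /primitive; apply: fine_cvg.
rewrite fineK; last exact: integrable_fin_num (density_integrable t dv).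
rewrite (_ : (fun x => (v x)%:E) = (fun x => limn (fun n => (u n x)%:E))).
  apply: cvg_monotone_convergence => //.
  - move=> n; apply/measurable_EFinP.
    exact: measurable_funS (density_measurable (du n)).
  - by move=> n x _; rewrite lee_fin (density_ge0 (du n)).
  - by move=> x _ m n mn; rewrite lee_fin undec.
apply/funext => x; apply/esym/cvg_lim => //.
by apply: cvg_EFin (uv x); apply: nearW.
Qed.

(** Lebesgue differentiation; a bound on the rate on [-m, m], with the compact
set inside, supplies the local integrability that it requires. *)
Lemma primitive_derivable u : density T u ->
  {ae mu, forall t, derivable (primitive u) t 1 /\
                    derive1 (primitive u) t = u t}.
Proof.
move=> du; apply: FTC1Ny; first by move=> y; exact: density_integrable.
split; [exact: density_measurable du|exact: openT|move=> K _ cK].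
have [M [_ MK]] := compact_bounded cK.
have sK : K `<=` `[- (`|M| + 1), `|M| + 1].
  move=> x Kx; rewrite /= in_itv/= -ler_norml; apply: MK => //.
  by rewrite (le_lt_trans (ler_norm M))// ltrDl.
case/integrableP: (density_integrable_itv (- (`|M| + 1)) (`|M| + 1) du) => mfu.
apply: le_lt_trans; apply: ge0_subset_integral => //.
  exact: compact_measurable.
by apply/measurable_EFinP/measurableT_comp => //; exact/measurable_EFinP.
Qed.

(** This is 1 - d <= exp(-d) for d = y - x, multiplied by exp y. *)
Lemma expRB_le (x y : R) : expR y - expR x <= expR y * (y - x).
Proof.
have -> : expR x = expR y * expR (x - y) by rewrite -expRD addrC subrK.
rewrite -[X in X - _]mulr1 -mulrBr ler_pM2l ?expR_gt0//.
by rewrite lerBlDr -lerBlDl opprB expR_ge1Dx.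
Qed.

(** On ]-oo, d] the exponential of the primitive is Lipschitz, with a constant
built from the maximal value exp(U(d)) and from a bound on the rate. *)
Lemma expR_primitive_ac u (c d : R) : density T u ->
  absolutely_continuous c d (fun t => expR (primitive u t)).
Proof.
move=> du e e0; have [M uM] := density_bounded du d.
(* the summand 1 keeps the constant positive when the bound is 0 *)
pose L := expR (primitive u d) * (`|M| + 1).
have L0 : 0 < L by rewrite mulr_gt0 ?expR_gt0// ltr_wpDl.
exists (e / L); first by rewrite divr_gt0.
move=> n p q pq _ spq.
rewrite (@le_lt_trans _ _ (L * \sum_(i < n) (q i - p i)))//; last first.
  by rewrite mulrC -ltr_pdivlMr.
rewrite mulr_sumr; apply: ler_sum => i _.
have [_ [piqi qid]] := pq i.
have nd := primitive_nd du piqi; rewrite ger0_norm ?subr_ge0 ?ler_expR ?nd//.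
apply: (le_trans (expRB_le _ _)); rewrite -mulrA.
apply: ler_pM; rewrite ?expR_ge0 ?subr_ge0 ?nd//.
  by rewrite ler_expR (primitive_nd du).
apply: (@primitive_lipschitz _ d _ _ _ du) => // r rd.
by rewrite (le_trans (uM _ rd))// (le_trans (ler_norm _))// lerDl.
Qed.

End primitive.

(** * The monotone operator on rates *)

(** A rate [u] is a fixed point exactly when exp U solves the equation: this is
the generalized Riccati equation of the mixed delay-advance equation. *)
Definition riccati (R : realType) (a b g h u : R -> R) (t : R) : R :=
  b t * expR (primitive u (h t) - primitive u t)
  - a t * expR (primitive u (g t) - primitive u t).

Section riccati.
Variables (R : realType) (T : R) (a b g h : R -> R).
Hypotheses (ma : measurable_fun setT a) (mg : measurable_fun setT g)
  (mh : measurable_fun setT h) (db : density T b).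
Hypotheses (a_ge0 : forall t, 0 <= a t) (ab : forall t, a t <= b t).
Hypotheses (g_le : forall t, g t <= t) (h_ge : forall t, t <= h t).
Hypothesis supersolution : forall t,
  b t * (expR (primitive b (h t) - primitive b t) - 1)
      * expR (primitive b t - primitive b (g t)) <= a t.
Implicit Types u v : R -> R.
Notation F := (riccati a b g h).

Lemma riccati_measurable u : density T u -> measurable_fun setT (F u).
Proof.
move=> du; have mP := primitive_measurable du.
have mexp (k : R -> R) : measurable_fun setT k ->
    measurable_fun setT (fun t => expR (primitive u (k t) - primitive u t)).
  move=> mk; apply: measurableT_comp => //.
  by apply: measurable_funB => //; apply: measurableT_comp.
apply: measurable_funB; apply: measurable_funM => //; try exact: mexp.
exact: density_measurable db.
Qed.

(** The advanced term grows with the integral of [u] over [t, h t], and the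
delayed term decreases with its integral over [g t, t]. *)
Lemma riccati_nd u v t : density T u -> density T v ->
  (forall r, u r <= v r) -> F u t <= F v t.
Proof.
move=> du dv uv; apply: lerB.
  rewrite ler_wpM2l ?(density_ge0 db)// ler_expR.
  exact: (primitiveB_le du dv).
rewrite ler_wpM2l ?a_ge0// ler_expR -lerN2 !opprB.
exact: (primitiveB_le du dv).
Qed.

Lemma riccati0_ge0 u t : (forall r, u r = 0) -> 0 <= F u t.
Proof.
move=> u0; have P0 r : primitive u r = 0.
  rewrite /primitive (@eq_Rintegral _ _ _ _ _ (cst 0)) => [|x _]; last exact: u0.
  by rewrite Rintegral_cst ?mul0r.
by rewrite /riccati !P0 subrr expR0 !mulr1 subr_ge0.
Qed.

(** Multiplying by exp(B(t) - B(g t)), for B the primitive of [b], clears the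
delayed exponential and gives back the hypothesis on [a]. *)
Lemma riccati_supersolution t : F b t <= b t.
Proof.
rewrite lerBlDr -lerBlDl -[X in _ - X]mulr1 -mulrBr.
rewrite -(@ler_pM2r _ (expR (primitive b t - primitive b (g t)))) ?expR_gt0//.
rewrite -[leRHS]mulrA -[X in _ <= _ * X]expRD addrA subrK subrr expR0 mulr1.
exact: supersolution.
Qed.

(* monotone iteration from the subsolution 0, below the supersolution b *)
Let it n := iter n F (cst 0).

Let it_spec n : (measurable_fun setT (it n)) /\
  forall t, 0 <= it n t <= b t /\ it n t <= it n.+1 t.
Proof.
have d0 : density T (cst 0).
  by apply: (density_le db) => // t; rewrite lexx (density_ge0 db).
elim: n => [|n [mn IH]].
  split=> [|t]; first exact: measurable_cst.
  by rewrite lexx (density_ge0 db)/=; split => //; exact: riccati0_ge0.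
have dn : density T (it n) by apply: (density_le db) => // t; case: (IH t).
have mn1 : measurable_fun setT (it n.+1) by exact: riccati_measurable.
have bn1 t : 0 <= it n.+1 t <= b t.
  case: (IH t) => /andP[n0 nb] nn1; rewrite (le_trans n0 nn1)/=.
  apply: le_trans (riccati_supersolution t); apply: riccati_nd => // r.
  by case: (IH r) => /andP[].
have dn1 : density T (it n.+1) by exact: (density_le db).
split=> // t; split=> //; apply: riccati_nd => // r.
by case: (IH r).
Qed.

(** The limit of the increasing iterates.  Monotone convergence makes their
primitives converge pointwise, and this is all that [F] depends on, so the
limit is a fixed point. *)
Lemma riccati_fixpoint : exists2 u, density T u & forall t, u t = F u t.
Proof.
have dit n : density T (it n).
  by case: (it_spec n) => mn nP; apply: (density_le db) => // t; case: (nP t).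
have itb n t : it n t <= b t by case: (it_spec n) => _ /(_ t) [/andP[]].
have itnd t : nondecreasing_seq (it ^~ t).
  by apply/nondecreasing_seqP => n; case: (it_spec n) => _ /(_ t) [].
pose u t := sup (range (it ^~ t)).
have itu t : it n t @[n --> \oo] --> u t.
  apply: nondecreasing_cvgn; first exact: itnd.
  by exists (b t) => _ [n _ <-].
have du : density T u.
  apply: (density_le db).
    apply: (@measurable_fun_cvg _ _ _ _ it) => [n|t _]; last exact: itu.
    exact: density_measurable (dit n).
  move=> t; apply/andP; split.
    rewrite -(cvg_lim (@Rhausdorff R) (itu t)); apply: limr_ge.
      by apply/cvg_ex; exists (u t); exact: itu.
    by apply: nearW => n; exact: (density_ge0 (dit n)).
  rewrite -(cvg_lim (@Rhausdorff R) (itu t)); apply: limr_le.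
    by apply/cvg_ex; exists (u t); exact: itu.
  by apply: nearW => n; exact: itb.
exists u => // t.
have Pcvg s : primitive (it n) s @[n --> \oo] --> primitive u s.
  exact: (@primitive_cvg _ T).
have expcvg r s : expR (primitive (it n) r - primitive (it n) s) @[n --> \oo]
    --> expR (primitive u r - primitive u s).
  apply: continuous_cvg; first exact: continuous_expR.
  exact: cvgB.
have Fcvg : F (it n) t @[n --> \oo] --> F u t.
  by apply: cvgB; apply: cvgMr; exact: expcvg.
have itSu : it n.+1 t @[n --> \oo] --> u t.
  by move: (itu t); rewrite -cvg_shiftS.
by rewrite -(cvg_lim (@Rhausdorff R) itSu); exact: cvg_lim Fcvg.
Qed.

End riccati.

(** * Borel representatives of Lebesgue measurable data *)

Section completion.
Variable R : realType.
Notation mu := (@lebesgue_measure R).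
Notation L := (lebesgueType R).
Implicit Types (A D E Z : set R) (f k : R -> R).

Lemma borel_lebesgue_measurable A : measurable A -> measurable (A : set L).
Proof. by move=> mA; exact: sub_caratheodory. Qed.

Lemma lebesgue_measurable_decomp A : measurable (A : set L) ->
  exists B Z, [/\ measurable B, measurable Z, mu Z = 0%E, B `<=` A &
                  A `\` B `<=` Z].
Proof.
move=> mA; have : (completed_algebra_gen mu).-sigma.-measurable A.
  by rewrite completed_caratheodory_measurable.
rewrite g_sigma_completed_algebra_genE => -[B mB] [N [Z [mZ Z0 NZ]] BNA].
exists B, Z; split => //; first by rewrite -BNA; exact: subsetUl.
by move=> t [] /=; rewrite -BNA => -[//|Nt _]; exact: NZ.
Qed.

Lemma negligible_borel_hull A : (leb R).-negligible A ->
  exists Z, [/\ measurable Z, mu Z = 0%E & A `<=` Z].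
Proof.
move=> [N [mN N0 AN]]; have [B [Z [mB mZ Z0 BN NBZ]]] := lebesgue_measurable_decomp mN.
have B0 : mu B = 0%E.
  apply/eqP; rewrite eq_le measure_ge0 andbT -N0.
  exact: le_outer_measure.
exists (B `|` Z); split; first exact: measurableU.
  by apply: null_set_setU.
move=> t At; have [Bt|nBt] := pselect (B t); [by left|right].
by apply: NBZ; split => //; exact: AN.
Qed.

Lemma borel_negligible_leb A : mu.-negligible A -> (leb R).-negligible A.
Proof.
move=> [Z [mZ Z0 AZ]]; exists Z; split => //.
exact: borel_lebesgue_measurable.
Qed.

(** Each preimage of a rational ray is Borel up to a null set.  Removing these
countably many null sets makes the preimages of rational rays Borel, and the
preimage of any other ray is a countable union of those. *)
Lemma lebesgue_measurable_borel_off_null D f : measurable D ->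
  lebesgue_measurable D f ->
  exists Z, [/\ measurable Z, mu Z = 0%E & measurable_fun (D `\` Z) f].
Proof.
move=> mD mf.
(* an enumeration of the rationals; the default value 0 is harmless *)
pose r n : R := ratr (odflt 0 (unpickle n)).
have ray n := lebesgue_measurable_decomp
  (mf (borel_lebesgue_measurable mD) _ (measurable_itv `]r n, +oo[)).
pose B n := projT1 (cid (ray n)).
pose Z n := projT1 (cid (projT2 (cid (ray n)))).
have BZ n : [/\ measurable (B n), measurable (Z n), mu (Z n) = 0%E,
    B n `<=` D `&` f @^-1` `]r n, +oo[ &
    (D `&` f @^-1` `]r n, +oo[) `\` B n `<=` Z n].
  exact: (projT2 (cid (projT2 (cid (ray n))))).
have mZ : measurable (\bigcup_n Z n).
  by apply: bigcup_measurable => n _; case: (BZ n).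
exists (\bigcup_n Z n); split => //.
  apply/negligibleP => //; apply: negligible_bigcup => n.
  by case: (BZ n) => _ ? ? _ _; exact/negligibleP.
apply: (measurability (@RGenOInfty.G R)) => [|_ [_ [x ->] <-]].
  exact: RGenOInfty.measurableE.
rewrite [X in measurable X](_ : _ =
  \bigcup_(n in [set n | x < r n]) (B n `\` \bigcup_n Z n)).
  by apply: bigcup_measurable => n _; apply: measurableD => //; case: (BZ n).
apply/seteqP; split => t.
  move=> [[Dt nZt]] /=; rewrite in_itv/= andbT => /rat_in_itvoo[q].
  rewrite in_itv/= => /andP[xq qf].
  have rq : r (pickle q) = ratr q by rewrite /r pickleK.
  exists (pickle q) => /=; first by rewrite rq.
  split=> //; apply: contrapT => nBt; apply: nZt; exists (pickle q) => //.
  case: (BZ (pickle q)) => _ _ _ _; apply; split => //; split => //=.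
  by rewrite rq in_itv/= qf.
move=> [n /= xn [Bt nZt]]; case: (BZ n) => _ _ _ /(_ _ Bt) [Dt] + _.
rewrite /= !in_itv/= !andbT => rf; split; first by split.
exact: lt_trans rf.
Qed.

(** Lebesgue measure on Borel sets is the image of its completion under the
identity, so this is a change of variables. *)
Lemma integral_lebE D f : measurable D -> measurable_fun D f ->
  (forall t, D t -> 0 <= f t) ->
  (\int[leb R]_(t in D) (f t)%:E = \int[mu]_(t in D) (f t)%:E)%E.
Proof.
move=> mD mf f0.
have mid : @measurable_fun _ _ L (measurableTypeR R) setT id.
  by move=> _ Y mY; rewrite setTI preimage_id; exact: borel_lebesgue_measurable.
have := @ge0_integral_pushforward _ _ L (measurableTypeR R) R id mid (leb R)
  D (EFin \o f) mD.
move=> <-; last 2 first.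
- exact/measurable_EFinP.
- by move=> y /set_mem Dy; rewrite lee_fin f0.
by apply: eq_measure_integral => A mA _.
Qed.

Lemma measurable_patch E f k : measurable E -> measurable_fun E f ->
  measurable_fun setT k -> measurable_fun setT (patch k E f).
Proof.
move=> mE mf mk; rewrite -(setUv E); apply/measurable_funU => //.
  exact: measurableC.
split.
  by apply: eq_measurable_fun mf => t tE; rewrite /patch tE.
apply: (@eq_measurable_fun _ _ _ _ _ k); last exact: measurable_funS mk.
by move=> t /set_mem tE; rewrite /patch memNset.
Qed.

(** The exceptional sets for the bounds on [t0, n], with n a natural number, are
absorbed into a single null set. *)
Lemma locally_ess_bounded_off_null (t0 : R) f : locally_ess_bounded t0 f ->
  exists Z, [/\ measurable Z, mu Z = 0%E & forall c, exists M, forall t,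
    ~ Z t -> t0 <= t <= c -> `|f t| <= M].
Proof.
move=> bf; pose M n := projT1 (cid (bf n%:R)).
have hull n := negligible_borel_hull (projT2 (cid (bf n%:R))).
pose Z n := projT1 (cid (hull n)).
have ZP n : [/\ measurable (Z n), mu (Z n) = 0%E &
    ~` [set t | t0 <= t <= n%:R -> `|f t| <= M n] `<=` Z n].
  exact: (projT2 (cid (hull n))).
have mZ : measurable (\bigcup_n Z n).
  by apply: bigcup_measurable => n _; case: (ZP n).
exists (\bigcup_n Z n); split => //.
  apply/negligibleP => //; apply: negligible_bigcup => n.
  by case: (ZP n) => ? ? _; exact/negligibleP.
move=> c; exists (M (Num.trunc `|c|).+1) => t nZt /andP[t0t tc].
apply: contrapT => Mt; apply: nZt; exists (Num.trunc `|c|).+1 => //.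
case: (ZP (Num.trunc `|c|).+1) => _ _; apply => /= /(_ _)/Mt; apply.
by rewrite t0t (le_trans tc)// (le_trans (ler_norm c))// ltW// truncnS_gt.
Qed.

(** Cutting [f] off outside [E] can only lower its integrals.  Essential
boundedness is what makes the integral of [f] finite; an infinite integral
would be read as 0 on the right-hand side. *)
Lemma primitive_patch_le (T t0 s t : R) E f :
  lebesgue_measurable `[t0, +oo[ f -> locally_ess_bounded t0 f ->
  (forall r, t0 <= r -> 0 <= f r) -> density T (patch (cst 0) E f) ->
  t0 <= s -> s <= t ->
  primitive (patch (cst 0) E f) t - primitive (patch (cst 0) E f) s <=
  \int[leb R]_(r in `[s, t]) f r.
Proof.
move=> mf bf f0 dfE t0s st; rewrite (primitiveB dfE st).
have mD : measurable (`[s, t] : set L).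
  exact: borel_lebesgue_measurable.
have subD : `[s, t] `<=` `[t0, +oo[.
  by move=> r /=; rewrite !in_itv/= andbT => /andP[sr _]; exact: le_trans sr.
have mfD : measurable_fun (`[s, t] : set L) (EFin \o f).
  apply/measurable_EFinP; apply: measurable_funS mf => //.
  exact: borel_lebesgue_measurable.
have fD0 r : `[s, t]%classic r -> (0 <= (f r)%:E)%E.
  by move=> /subD; rewrite /= in_itv/= andbT lee_fin => /f0.
have finD : (\int[leb R]_(r in `[s, t]) (f r)%:E < +oo)%E.
  have [M MP] := bf t.
  apply: (@le_lt_trans _ _ (\int[leb R]_(r in `[s, t]) (`|M|%:E))%E).
    apply: ae_ge0_le_integral => //.
    apply: (@filterS _ _ (ae_filter_ringOfSetsType (leb R))) MP => r MP str; rewrite lee_fin.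
    rewrite (le_trans (ler_norm _))// (le_trans (MP _))// ?ler_norm//.
    by move: str; rewrite /= in_itv/= => /andP[sr ->]; rewrite (le_trans t0s sr).
  rewrite integral_cst//.
  rewrite [X in (_ * X)%E](_ : _ = mu `[s, t])//.
  rewrite [X in (_ * X)%E]lebesgue_measure_itv/=; case: ifPn => _.
    by rewrite -EFinB -EFinM ltry.
  by rewrite mule0 ltry.
have mfE : measurable_fun setT (patch (cst 0) E f) by exact: density_measurable dfE.
rewrite /Rintegral fine_le//.
- by apply: integrable_fin_num => //; exact: density_integrable_itv dfE.
- by rewrite ge0_fin_numE// integral_ge0.
rewrite -integral_lebE//; last 2 first.
- exact: measurable_funS mfE.
- by move=> r _; exact: density_ge0 dfE r.
apply: ge0_le_integral => //.
- by move=> r _; rewrite lee_fin (density_ge0 dfE).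
- apply/measurable_EFinP => _ Y mY; apply: borel_lebesgue_measurable.
  by apply: measurableI => //; rewrite -(setTI (_ @^-1` _)); exact: mfE.
- move=> r rD; rewrite lee_fin /patch; case: ifPn => // _.
  by rewrite -lee_fin; exact: fD0.
Qed.

End completion.

(** * Existence of the solution *)

Unset Implicit Arguments.

Theorem corollary2p2 (R : realType) (t0 : R) (a b g h : R -> R)
  (ma : lebesgue_measurable `[t0, +oo[ a)
  (mb : lebesgue_measurable `[t0, +oo[ b)
  (mg : lebesgue_measurable `[t0, +oo[ g)
  (mh : lebesgue_measurable `[t0, +oo[ h)
  (ba : locally_ess_bounded t0 a)
  (bb : locally_ess_bounded t0 b)
  (bg : locally_ess_bounded t0 g)
  (bh : locally_ess_bounded t0 h)
  (a_ge0 : forall t : R, t0 <= t -> 0 <= a t)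
  (b_ge0 : forall t : R, t0 <= t -> 0 <= b t)
  (g_le : forall t : R, t0 <= t -> g t <= t)
  (h_ge : forall t : R, t0 <= t -> t <= h t)
  (g_oo : g t @[t --> +oo] --> +oo)
  (ab_cond : \forall t \near +oo,
     a t <= b t /\
     b t * (expR (\int[leb R]_(s in `[t, h t]) b s) - 1)
         * expR (\int[leb R]_(s in `[g t, t]) b s) <= a t) :
  exists (t1 : R) (phi : R -> R) (x0 : R) (x : R -> R),
    [/\ t0 <= t1,
        mixed_solution a b g h t1 phi x0 x,
        \forall t \near +oo, 0 < x t &
        exists T : R, {ae leb R, forall t : R, T <= t -> 0 <= derive1 x t}].
Proof.
have [T [t0T Tcond]] : exists T, t0 <= T /\ forall t, T <= t ->
    t0 <= g t /\ a t <= b t /\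
    b t * (expR (\int[leb R]_(s in `[t, h t]) b s) - 1)
        * expR (\int[leb R]_(s in `[g t, t]) b s) <= a t.
  have gt0 : \forall t \near +oo, t0 <= g t by move/cvgryPge : g_oo; exact.
  have [K [_ KP]] := filterI gt0 ab_cond.
  exists (Num.max t0 (K + 1)); split; first by rewrite le_max lexx.
  by move=> t; rewrite ge_max => /andP[_ Kt]; apply: KP; rewrite (lt_le_trans _ Kt)// ltrDl.
have mD : measurable `[t0, +oo[ by exact: measurable_itv.
have [Za [mZa Za0 maZ]] := lebesgue_measurable_borel_off_null mD ma.
have [Zb [mZb Zb0 mbZ]] := lebesgue_measurable_borel_off_null mD mb.
have [Zg [mZg Zg0 mgZ]] := lebesgue_measurable_borel_off_null mD mg.
have [Zh [mZh Zh0 mhZ]] := lebesgue_measurable_borel_off_null mD mh.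
have [Zm [mZm Zm0 bM]] := locally_ess_bounded_off_null bb.
pose Z := Za `|` Zb `|` Zg `|` Zh `|` Zm.
have mZ : measurable Z by do ! apply: measurableU => //.
have Z0 : (@lebesgue_measure R).-negligible Z.
  by do ! apply: negligibleU => //; apply/negligibleP.
(* the set on which the original data are kept *)
pose E := `[T, +oo[ `\` Z.
have mE : measurable E by exact: measurableD.
have subE Y : Y `<=` Z -> E `<=` `[t0, +oo[ `\` Y.
  move=> YZ t [Tt nZt]; split; last by move/YZ.
  by move: Tt; rewrite /= !in_itv/= !andbT; exact: le_trans.
have Et0 t : t \in E -> t0 <= t.
  by rewrite inE => /(subE _ (@sub0set _ _)) [+ _]; rewrite /= in_itv/= andbT.
have ET t : t \in E -> T <= t by rewrite inE => -[+ _]; rewrite /= in_itv/= andbT.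
have mES Y f : Y `<=` Z -> measurable Y -> measurable_fun (`[t0, +oo[ `\` Y) f -> measurable_fun E f.
  by move=> YZ mY; apply: measurable_funS; [exact: measurableD|exact: subE].
pose a' := patch (cst 0) E a; pose b' := patch (cst 0) E b.
pose g' := patch id E g; pose h' := patch id E h.
have ma' : measurable_fun setT a'.
  apply: measurable_patch => //; apply: mES maZ => //.
  by move=> t Yt; do 4 left.
have mb' : measurable_fun setT b'.
  apply: measurable_patch => //; apply: mES mbZ => //.
  by move=> t Yt; do 3 left; right.
have mg' : measurable_fun setT g'.
  apply: measurable_patch => //; apply: mES mgZ => //.
  by move=> t Yt; do 2 left; right.
have mh' : measurable_fun setT h'.
  apply: measurable_patch => //; apply: mES mhZ => //.
  by move=> t Yt; left; right.
have a'0 t : 0 <= a' t.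
  by rewrite /a' /patch; case: ifPn => // /Et0/a_ge0.
have ab' t : a' t <= b' t.
  by rewrite /a' /b' /patch; case: ifPn => // /ET/Tcond[_ []].
have g'_le t : g' t <= t by rewrite /g' /patch; case: ifPn => // /Et0/g_le.
have h'_ge t : t <= h' t by rewrite /h' /patch; case: ifPn => // /Et0/h_ge.
have db' : density T b'.
  split=> //.
  - by move=> t; exact: le_trans (ab' t).
  - by move=> t tT; rewrite /b' /patch; case: ifPn => // /ET; rewrite leNgt tT.
  - move=> c; have [M MP] := bM c; exists `|M| => t tc.
    rewrite /b' /patch; case: ifPn => [tE|_]; last exact: normr_ge0.
    rewrite (le_trans (ler_norm _))// (le_trans (MP t _ _))// ?ler_norm//.
      by move: tE; rewrite inE => -[_ nZt] Zt; apply: nZt; right.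
    by rewrite tc Et0.
have super t : b' t * (expR (primitive b' (h' t) - primitive b' t) - 1)
      * expR (primitive b' t - primitive b' (g' t)) <= a' t.
  have [tE|tE] := boolP (t \in E); last first.
    by rewrite /b' {1}/patch (negbTE tE)/= !mul0r.
  have [t0g [_ le_a]] := Tcond _ (ET _ tE).
  have t0t := Et0 _ tE.
  have gt : g t <= t by exact: g_le.
  have th : t <= h t by exact: h_ge.
  rewrite /a' /g' /h' /patch tE; apply: le_trans le_a.
  rewrite {1}/b' /patch tE; apply: ler_pM.
  - by rewrite mulr_ge0 ?b_ge0// subr_ge0 -expR0 ler_expR subr_ge0 (primitive_nd db').
  - exact: expR_ge0.
  - rewrite ler_wpM2l ?b_ge0// lerD2r ler_expR.
    exact: (primitive_patch_le mb bb b_ge0 db').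
  - rewrite ler_expR; exact: (primitive_patch_le mb bb b_ge0 db').
have [u du uF] := riccati_fixpoint ma' mg' mh' db' a'0 ab' g'_le h'_ge super.
pose x t := expR (primitive u t).
have Dx t : derivable (primitive u) t 1 /\ derive1 (primitive u) t = u t ->
    derivable x t 1 /\ derive1 x t = u t * x t.
  move=> [dP Pu].
  have isP : is_derive t 1 (primitive u) (u t).
    by apply: DeriveDef => //; rewrite -derive1E.
  have isx : is_derive t 1 x (x t * u t).
    exact: (is_derive1_comp (is_derive_expR (primitive u t)) isP).
  split; first by case: isx.
  by rewrite derive1E; case: isx => _ ->; rewrite mulrC.
have aeP : {ae leb R, forall t, derivable x t 1 /\ derive1 x t = u t * x t}.
  apply: borel_negligible_leb; apply: negligibleS (primitive_derivable du).
  by move=> t /= nx Pt; apply: nx; exact: Dx.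
(* the history of the solution is x itself, constant to the left of T *)
exists T, x, (x T), x; split => //.
- split=> //; first by move=> c _; exact: expR_primitive_ac du.
  have aeZ : {ae leb R, forall t, ~ Z t}.
    by apply: borel_negligible_leb; apply: negligibleS Z0 => t /= /contrapT.
  apply: (@filterS2 _ _ (ae_filter_ringOfSetsType (leb R))) aeP aeZ => t [dx x't] nZt Tt; split => //.
  have tE : t \in E by rewrite inE; split => //=; rewrite in_itv/= Tt.
  rewrite x't uF /riccati /a' /b' /g' /h' /patch tE /x mulrBl -!mulrA -!expRD !subrK.
  by rewrite subrr.
- by apply: nearW => t; exact: expR_gt0.
- exists T; apply: (@filterS _ _ (ae_filter_ringOfSetsType (leb R))) aeP => t [_ ->] _.
  by rewrite mulr_ge0 ?expR_ge0// (density_ge0 du).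
Qed.
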